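(* ${\bf ITL}^0$ is sound for the class of dynamical systems: whenever ${\bf ITL}^0\vdash\varphi$, then for every dynamical system $(X,\mathcal T,S)$ and every valuation $[\![\cdot]\!]$ on it, $[\![\varphi]\!]=X$.
   Context: The language $\mathcal L$ is given by $\bot \mid p \mid \varphi\wedge\psi\mid\varphi\vee\psi\mid\varphi\to\psi\mid\circ\varphi\mid\Diamond\varphi\mid\Box\varphi$, with $\neg\varphi:=\varphi\to\bot$. The logic ${\bf ITL}^0$ is the least set of $\mathcal L$-formulas containing all intuitionistic tautologies, $\neg\circ\bot$, $\circ(\varphi\wedge\psi)\leftrightarrow(\circ\varphi\wedge\circ\psi)$, $\circ(\varphi\vee\psi)\leftrightarrow(\circ\varphi\vee\circ\psi)$, $\circ(\varphi\to\psi)\to(\circ\varphi\to\circ\psi)$, $\Box(\varphi\to\psi)\to(\Box\varphi\to\Box\psi)$, $\Box(\varphi\to\psi)\to(\Diamond\varphi\to\Diamond\psi)$, $\Diamond(\varphi\vee\psi)\to(\Diamond\varphi\vee\Diamond\psi)$, $\Box\varphi\to\varphi\wedge\circ\Box\varphi$, $\varphi\vee\circ\Diamond\varphi\to\Diamond\varphi$, and closed under the rules: from $\varphi\to\circ\varphi$ infer $\varphi\to\Box\varphi$; from $\circ\varphi\to\varphi$ infer $\Diamond\varphi\to\varphi$; modus ponens; from $\varphi$ infer $\circ\varphi$. A dynamical system is $(X,\mathcal T,S)$ with $(X,\mathcal T)$ a topological space and $S$ continuous. A valuation maps formulas to open sets with $[\![\bot]\!]=\varnothing$, $[\![\varphi\wedge\psi]\!]=[\![\varphi]\!]\cap[\![\psi]\!]$,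 $[\![\varphi\vee\psi]\!]=[\![\varphi]\!]\cup[\![\psi]\!]$, $[\![\varphi\to\psi]\!]=((X\setminus[\![\varphi]\!])\cup[\![\psi]\!])^\circ$, $[\![\circ\varphi]\!]=S^{-1}[\![\varphi]\!]$, $[\![\Diamond\varphi]\!]=\bigcup_{n\ge0}S^{-n}[\![\varphi]\!]$, $[\![\Box\varphi]\!]=\bigcup\{U\in\mathcal T:S[U]\subseteq U\subseteq[\![\varphi]\!]\}$. *)

(* Defs.v *)
From mathcomp Require Import all_boot.
From mathcomp Require Import boolp classical_sets topology.

Set Implicit Arguments.
Unset Strict Implicit.
Unset Printing Implicit Defensive.

Local Open Scope classical_set_scope.

Inductive form (P : Type) : Type :=
| Bot
| Var of P
| And of form P & form P
| Or of form P & form P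
| Imp of form P & form P
| Next of form P
| Dia of form P
| Box of form P.

Arguments Bot {P}.

Declare Scope itl_scope.
Delimit Scope itl_scope with itl.
Bind Scope itl_scope with form.

Notation "⊥" := Bot (at level 0) : itl_scope.
Notation "○ a" := (Next a) (at level 30, right associativity) : itl_scope.
Notation "◇ a" := (Dia a) (at level 30, right associativity) : itl_scope.
Notation "□ a" := (Box a) (at level 30, right associativity) : itl_scope.
Notation "a ⋏ b" := (And a b) (at level 40, left associativity) : itl_scope.
Notation "a ⋎ b" := (Or a b) (at level 50, left associativity) : itl_scope.
Notation "a ⇒ b" := (Imp a b) (at level 55, right associativity) : itl_scope.

Definition Neg (P : Type) (a : form P) : form P := (a ⇒ ⊥)%itl.
Definition Iff (P : Type) (a b : form P) : form P :=
  ((a ⇒ b) ⋏ (b ⇒ a))%itl.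

Notation "∼ a" := (Neg a) (at level 30, right associativity) : itl_scope.
Notation "a ⇔ b" := (Iff a b) (at level 60, no associativity) : itl_scope.

(* Gentzen's natural deduction NJ for intuitionistic propositional logic.  No
   rule looks under ○, ◇ or □, so formulas headed by a modality behave as
   atoms. *)
Inductive NJ (P : Type) : set (form P) -> form P -> Prop :=
| NJ_hyp G a : G a -> NJ G a
| NJ_botE G a : NJ G ⊥%itl -> NJ G a
| NJ_andI G a b : NJ G a -> NJ G b -> NJ G (a ⋏ b)%itl
| NJ_andEl G a b : NJ G (a ⋏ b)%itl -> NJ G a
| NJ_andEr G a b : NJ G (a ⋏ b)%itl -> NJ G b
| NJ_orIl G a b : NJ G a -> NJ G (a ⋎ b)%itl
| NJ_orIr G a b : NJ G b -> NJ G (a ⋎ b)%itl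
| NJ_orE G a b c :
    NJ G (a ⋎ b)%itl -> NJ (G `|` [set a]) c -> NJ (G `|` [set b]) c -> NJ G c
| NJ_impI G a b : NJ (G `|` [set a]) b -> NJ G (a ⇒ b)%itl
| NJ_impE G a b : NJ G (a ⇒ b)%itl -> NJ G a -> NJ G b.

(* Equivalently, the substitution instances in the full language of the
   theorems of intuitionistic propositional logic. *)
Definition int_tautology (P : Type) (a : form P) : Prop := NJ set0 a.

Inductive ITL0 (P : Type) : form P -> Prop :=
| ITL0_taut a : int_tautology a -> ITL0 a
| ITL0_next_bot : ITL0 (∼ ○ ⊥)%itl
| ITL0_next_and a b : ITL0 (○ (a ⋏ b) ⇔ (○ a ⋏ ○ b))%itl
| ITL0_next_or a b : ITL0 (○ (a ⋎ b) ⇔ (○ a ⋎ ○ b))%itl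
| ITL0_next_imp a b : ITL0 (○ (a ⇒ b) ⇒ (○ a ⇒ ○ b))%itl
| ITL0_box_imp a b : ITL0 (□ (a ⇒ b) ⇒ (□ a ⇒ □ b))%itl
| ITL0_box_dia a b : ITL0 (□ (a ⇒ b) ⇒ (◇ a ⇒ ◇ b))%itl
| ITL0_dia_or a b : ITL0 (◇ (a ⋎ b) ⇒ (◇ a ⋎ ◇ b))%itl
| ITL0_box_fix a : ITL0 (□ a ⇒ (a ⋏ ○ □ a))%itl
| ITL0_dia_fix a : ITL0 ((a ⋎ ○ ◇ a) ⇒ ◇ a)%itl
| ITL0_box_ind a : ITL0 (a ⇒ ○ a)%itl -> ITL0 (a ⇒ □ a)%itl
| ITL0_dia_ind a : ITL0 (○ a ⇒ a)%itl -> ITL0 (◇ a ⇒ a)%itl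
| ITL0_mp a b : ITL0 (a ⇒ b)%itl -> ITL0 a -> ITL0 b
| ITL0_nec_next a : ITL0 a -> ITL0 (○ a)%itl.

Record dynamicalSystem : Type := DynamicalSystem {
  ds_space :> topologicalType;
  ds_map : ds_space -> ds_space;
  ds_continuous : continuous ds_map }.

Record is_valuation (P : Type) (X : dynamicalSystem)
    (v : form P -> set X) : Prop := IsValuation {
  val_open : forall a, open (v a);
  val_bot : v ⊥%itl = set0;
  val_and : forall a b, v (a ⋏ b)%itl = v a `&` v b;
  val_or : forall a b, v (a ⋎ b)%itl = v a `|` v b;
  val_imp : forall a b, v (a ⇒ b)%itl = interior (~` v a `|` v b);
  val_next : forall a, v (○ a)%itl = @ds_map X @^-1` v a;
  val_dia : forall a,
    v (◇ a)%itl = \bigcup_n (iter n (@ds_map X) @^-1` v a);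
  val_box : forall a,
    v (□ a)%itl =
      \bigcup_(U in [set U : set X |
        [/\ open U, @ds_map X @` U `<=` U & U `<=` v a]]) U }.

(* Main.v *)
(* A formula [a ⇒ b] holds everywhere iff [v a `<=` v b], and an open set [U] is
   contained in [v (a ⇒ b)] iff [U `&` v a `<=` v b].  Thus intuitionistic
   derivability is sound with respect to inclusion of open sets, and the modal
   axioms become facts about preimages under [S]: [v (□ a)] is the largest open
   [S]-invariant subset of [v a], and [v (◇ a)] is the set of points whose orbit
   meets [v a]. *)
Require Import Defs.
From mathcomp Require Import all_boot.
From mathcomp Require Import boolp classical_sets topology.

Local Open Scope classical_set_scope.

Section Valuation.
Context {P : Type} {X : dynamicalSystem} {v : form P -> set X}.
Context (hv : is_valuation v).
Local Notation S := (@ds_map X).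
Implicit Types (a b : form P) (U : set X).

Lemma sub_val_imp {a b U} : open U ->
  U `<=` v (a ⇒ b)%itl <-> U `&` v a `<=` v b.
Proof.
move=> oU; rewrite (val_imp hv) -open_subsetE//; split=> [h x [Ux ax]|h x Ux].
  by have [] := h _ Ux.
by have [ax|nax] := pselect (v a x); [right; apply: h | left].
Qed.

Lemma val_impE {a b x} : v (a ⇒ b)%itl x -> v a x -> v b x.
Proof.
(* Modus ponens at a point is the case where [U] is the value of the implication itself. *)
move=> hab ha; have /sub_val_imp := @subset_refl _ (v (a ⇒ b)%itl).
by apply; [exact: val_open|].
Qed.

Lemma val_imp_setT {a b} : v (a ⇒ b)%itl = setT <-> v a `<=` v b.
Proof.
by rewrite -subTset sub_val_imp ?setTI//; exact: openT.
Qed.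

Lemma val_iff_setT a b : v a = v b -> v (a ⇔ b)%itl = setT.
Proof.
move=> ab; have ab_sub : v a `<=` v b by rewrite ab.
have ba_sub : v b `<=` v a by rewrite ab.
rewrite (val_and hv) (val_imp_setT.2 ab_sub) (val_imp_setT.2 ba_sub).
exact: setTI.
Qed.

Lemma val_box_sub a : v (□ a)%itl `<=` v a.
Proof. by rewrite (val_box hv) => x [U [_ _ Ua] Ux]; exact: Ua. Qed.

(** Each point shares an invariant open set of the union with its image. *)
Lemma val_box_inv a : S @` v (□ a)%itl `<=` v (□ a)%itl.
Proof.
rewrite (val_box hv) => _ [x [U hU Ux] <-].
by exists U => //; case: hU => _ SU _; apply: SU; exists x.
Qed.

(** Coinduction for [□], behind both its distribution over [⇒] and its induction rule. *)
Lemma sub_val_box {a U} :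
  open U -> S @` U `<=` U -> U `<=` v a -> U `<=` v (□ a)%itl.
Proof. by move=> oU SU Ua x Ux; rewrite (val_box hv); exists U. Qed.

Lemma val_box_iter {a x} n : v (□ a)%itl x -> v (□ a)%itl (iter n S x).
Proof.
move=> ax; elim: n => [//|n IH]; rewrite iterS.
by apply: val_box_inv; exists (iter n S x).
Qed.

(* [G] may be infinite, so the hypotheses are bounded below by an arbitrary open
   set instead of by the intersection of their values, which need not be open. *)
Lemma NJ_sound {G : set (form P)} {a} : NJ G a ->
  forall U, open U -> (forall g, G g -> U `<=` v g) -> U `<=` v a.
Proof.
(* Discharging a hypothesis [c] shrinks the bound [U] to its intersection with [v c], again open. *)
have ext (H : set (form P)) c U : (forall g, H g -> U `<=` v g) ->
    forall g, (H `|` [set c]) g -> U `&` v c `<=` v g.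
  by move=> hU g [/hU Ug x [/Ug]|-> x []].
elim=> {G a}.
- by move=> G a Ga U _; apply.
- by move=> G a _ IH U oU hU x /(IH _ oU hU); rewrite (val_bot hv).
- move=> G a b _ IHa _ IHb U oU hU x Ux; rewrite (val_and hv).
  by split; [exact: IHa Ux | exact: IHb Ux].
- by move=> G a b _ IH U oU hU x /(IH _ oU hU); rewrite (val_and hv) => -[].
- by move=> G a b _ IH U oU hU x /(IH _ oU hU); rewrite (val_and hv) => -[].
- by move=> G a b _ IH U oU hU x /(IH _ oU hU); rewrite (val_or hv); left.
- by move=> G a b _ IH U oU hU x /(IH _ oU hU); rewrite (val_or hv); right.
- move=> G a b c _ IHab _ IHa _ IHb U oU hU x Ux.
  (* [U] may lie in neither disjunct as a whole, so the disjunct is chosen at [x] and [U] is cut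
     down to it. *)
  have := IHab _ oU hU x Ux; rewrite (val_or hv) => -[ax|bx].
    by apply: (IHa (U `&` v a)) => //; [exact/openI/val_open | exact: ext].
  by apply: (IHb (U `&` v b)) => //; [exact/openI/val_open | exact: ext].
- move=> G a b _ IH U oU hU; apply/sub_val_imp => //.
  by apply: IH; [exact/openI/val_open | exact: ext].
- move=> G a b _ IHab _ IHa U oU hU x Ux.
  by apply: (val_impE (IHab _ oU hU x Ux)); exact: IHa Ux.
Qed.

End Valuation.

Theorem theorem5p2 (P : Type) (phi : form P) (hphi : ITL0 phi)
    (X : dynamicalSystem) (v : form P -> set X) (hv : is_valuation v) :
  v phi = [set: X].
Proof.
elim: hphi => {phi}.
- move=> a ha; rewrite -subTset.
  by apply: (NJ_sound hv ha); [exact: openT | move=> g []].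
- by apply/(val_imp_setT hv); rewrite (val_next hv) (val_bot hv).
- by move=> a b; apply: val_iff_setT => //; rewrite !(val_and hv, val_next hv).
- by move=> a b; apply: val_iff_setT => //; rewrite !(val_or hv, val_next hv).
- move=> a b; apply/(val_imp_setT hv)/(sub_val_imp hv); first exact: val_open.
  by rewrite !(val_next hv) => x [] /=; exact: val_impE.
- move=> a b; apply/(val_imp_setT hv)/(sub_val_imp hv); first exact: val_open.
  (* The coinduction set is the intersection of the two boxes. *)
  apply: sub_val_box => //.
  + by apply: openI; exact: val_open.
  + by move=> _ [x [hab ha] <-]; split; apply: val_box_inv => //; exists x.
  + move=> x [/(val_box_sub hv) hab /(val_box_sub hv) ha].
    exact: (val_impE hv hab ha).
- move=> a b; apply/(val_imp_setT hv)/(sub_val_imp hv); first exact: val_open.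
  rewrite !(val_dia hv) => x [hab [n _ ha]]; exists n => //.
  (* Invariance carries the implication along the orbit to the time [n] at which [a] holds. *)
  have /(val_box_sub hv) hab_n := val_box_iter hv n hab.
  exact: (val_impE hv hab_n ha).
- move=> a b; apply/(val_imp_setT hv).
  rewrite (val_or hv) !(val_dia hv) (val_or hv) => x [n _ [ha|hb]].
    by left; exists n.
  by right; exists n.
- move=> a; apply/(val_imp_setT hv); rewrite (val_and hv) (val_next hv) => x ax.
  by split; [exact: val_box_sub ax | apply: val_box_inv => //; exists x].
- move=> a; apply/(val_imp_setT hv).
  rewrite (val_or hv) (val_next hv) (val_dia hv) => x [ax|[n _ ax]].
    by exists 0.
  (* The witness [n] counts from [S x], hence one more step from [x]. *)
  by exists n.+1 => //; rewrite /preimage /= -iterS iterSr.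
- move=> a _ /(val_imp_setT hv); rewrite (val_next hv) => inv.
  (* By the premise, [v a] is itself invariant. *)
  apply/(val_imp_setT hv)/sub_val_box => //; first exact: val_open.
  by move=> _ [x /inv ? <-].
- move=> a _ /(val_imp_setT hv); rewrite (val_next hv) => inv.
  apply/(val_imp_setT hv); rewrite (val_dia hv) => x [n _].
  (* The premise pulls [a] back along the orbit, from time [n] down to [x]. *)
  by rewrite /preimage /=; elim: n => [//|n IH]; rewrite iterS => /inv.
- by move=> a b _ /(val_imp_setT hv) ab _ aT; rewrite -subTset -aT.
- by move=> a _ aT; rewrite (val_next hv) aT preimage_setT.
Qed.
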